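(* Let $(\mathcal{A},* )$ be a $^*$-ring with center $Z(\mathcal{A})$. Let $q+\varepsilon a\in\mathcal{A}[\varepsilon]/(\varepsilon^2)$ (with $q,a\in\mathcal{A}$) be an idempotent such that $qq^*q\in Z(\mathcal{A})q$, and let $$\mathcal{L}_q(a):=2[a^*,qq^*q]+[qa^*q,q^*].$$ Then $q+\varepsilon\mathcal{L}_q(a)$ is an idempotent, and writing $qq^*q=rq$ for $r\in Z(\mathcal{A})$, we have $$\mathcal{L}_q^2(a)=-4r^3a.$$ Furthermore, for all $s\in Z(\mathcal{A})$, $\mathcal{L}_q(sa)=s^*\mathcal{L}_q(a)$.
   Context: Rings are associative and unital. A $^*$-ring is a ring $\mathcal{A}$ with an additive involution $*:\mathcal{A}\to\mathcal{A}$ such that $(xy)^*=y^*x^*$ for all $x,y$. $[x,y]=xy-yx$. In $\mathcal{A}[\varepsilon]/(\varepsilon^2)$ the element $\varepsilon$ is central. $\mathcal{L}_q^2(a)$ means $\mathcal{L}_q(\mathcal{L}_q(a))$. *)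

(* Defs.v *)
From HB Require Import structures.
From mathcomp Require Import all_boot ssralg.

Set Implicit Arguments.
Unset Strict Implicit.
Unset Printing Implicit Defensive.

Import GRing.Theory.
Local Open Scope ring_scope.

(* Rings are [pzRingType]s, so that the zero ring is not excluded. *)

HB.mixin Record PzRing_isStarRing A of GRing.PzRing A := {
  star : A -> A;
  starD : {morph star : x y / x + y};
  starM : forall x y, star (x * y) = star y * star x;
  starK : involutive star
}.

#[short(type="starRingType")]
HB.structure Definition StarRing := {A of GRing.PzRing A & PzRing_isStarRing A}.

Definition central (A : pzRingType) (z : A) : Prop :=
  forall x : A, GRing.comm z x.

Definition bracket (A : pzRingType) (x y : A) : A := x * y - y * x.

Definition is_idempotent (A : pzRingType) (e : A) : Prop := e * e = e.

(* The ring A[eps]/(eps^2), eps central, for a possibly noncommutative ring A: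
   [Dual x y] is the class of x + eps y. *)
Record dual (A : Type) : Type := Dual { dual_re : A; dual_inf : A }.

Definition pair_of_dual (A : Type) (u : dual A) : A * A :=
  (dual_re u, dual_inf u).
Definition dual_of_pair (A : Type) (p : A * A) : dual A := Dual p.1 p.2.

Lemma pair_of_dualK (A : Type) : cancel (@pair_of_dual A) (@dual_of_pair A).
Proof. by case. Qed.

HB.instance Definition _ (A : choiceType) :=
  Choice.copy (dual A) (can_type (@pair_of_dualK A)).

Section DualRing.
Variable A : pzRingType.
Implicit Types u v w : dual A.

Definition dual_zero : dual A := Dual 0 0.
Definition dual_opp u : dual A := Dual (- dual_re u) (- dual_inf u).
Definition dual_add u v : dual A :=
  Dual (dual_re u + dual_re v) (dual_inf u + dual_inf v).
Definition dual_one : dual A := Dual 1 0.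
Definition dual_mul u v : dual A :=
  Dual (dual_re u * dual_re v)
       (dual_re u * dual_inf v + dual_inf u * dual_re v).

Lemma dual_addA : associative dual_add.
Proof. by move=> u v w; rewrite /dual_add /= !addrA. Qed.
Lemma dual_addC : commutative dual_add.
Proof. by move=> u v; congr Dual; rewrite addrC. Qed.
Lemma dual_add0 : left_id dual_zero dual_add.
Proof. by case=> x y; congr Dual; rewrite add0r. Qed.
Lemma dual_addN : left_inverse dual_zero dual_opp dual_add.
Proof. by move=> u; congr Dual; rewrite addNr. Qed.

HB.instance Definition _ :=
  GRing.isZmodule.Build (dual A) dual_addA dual_addC dual_add0 dual_addN.

Lemma dual_mulA : associative dual_mul.
Proof.
by move=> u v w; congr Dual; rewrite /= ?mulrDr ?mulrDl !mulrA ?addrA.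
Qed.
Lemma dual_mul1l : left_id dual_one dual_mul.
Proof. by case=> x y; congr Dual; rewrite /= !mul1r // mul0r addr0. Qed.
Lemma dual_mul1r : right_id dual_one dual_mul.
Proof. by case=> x y; congr Dual; rewrite /= !mulr1 // mulr0 add0r. Qed.
Lemma dual_mulDl : left_distributive dual_mul +%R.
Proof. by move=> u v w; congr Dual; rewrite /= ?mulrDl // addrACA. Qed.
Lemma dual_mulDr : right_distributive dual_mul +%R.
Proof. by move=> u v w; congr Dual; rewrite /= ?mulrDr // addrACA. Qed.

HB.instance Definition _ :=
  GRing.Zmodule_isPzRing.Build (dual A)
    dual_mulA dual_mul1l dual_mul1r dual_mulDl dual_mulDr.

Definition dual_const (x : A) : dual A := Dual x 0.
Definition eps : dual A := Dual 0 1.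

Lemma dual_constB : {morph dual_const : x y / x - y}.
Proof. by move=> x y; congr Dual; rewrite /= subr0. Qed.

Lemma dual_constM : {morph dual_const : x y / x * y}.
Proof. by move=> x y; congr Dual; rewrite /= mulr0 mul0r addr0. Qed.

Lemma dual_const1 : dual_const 1 = 1.
Proof. by []. Qed.

Lemma dual_eps_central : central eps.
Proof.
by move=> u; congr Dual; rewrite /= !(mul0r, mulr0, mul1r, mulr1, add0r, addr0).
Qed.

Lemma dual_eps_sq : eps * eps = 0.
Proof. by congr Dual; rewrite /= !(mul0r, mulr0, addr0). Qed.

Lemma dual_eps_decomp (x y : A) : dual_const x + eps * dual_const y = Dual x y.
Proof. by congr Dual; rewrite /= !(mul0r, mul1r, add0r, addr0). Qed.

End DualRing.

Arguments eps {A}.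

Definition Lq (A : starRingType) (q a : A) : A :=
  2%:R * bracket (star a) (q * star q * q)
  + bracket (q * star a * q) (star q).

(* Main.v *)
Require Import Defs.
From mathcomp Require Import all_boot ssralg.

Import GRing.Theory.
Local Open Scope ring_scope.

(** The pair [q], [a] gives an idempotent [q + eps a] exactly when [q] is
idempotent and [a] is a tangent vector to the idempotents at [q], that is,
[q a + a q = a].  So the first claim says that [Lq q] takes values in the
tangent vectors at [q], and these are closed under sums and central multiples.
Every [[x, q]] with [q] idempotent is tangent, and so is [[q x q, p]] as soon
as [q p q] is a central multiple [r q] of [q], because then the two unwanted
terms [q (p q x q)] and [(q x q p) q] of the tangency equation are both equal
to [r q x q].

For the square, put [p = star q] and [t = star r].  Applying the involution to
[q p q = r q] gives [p q p = t p], and the computation takes place in the bare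
ring with two such elements:
[star (Lq q a) = 2 t [p, a] + [q, p a p] =: c] and
[Lq q (Lq q a) = 2 r [c, q] + [q c q, p]].
The scalars [r] and [t] may differ, but they agree on every multiple of [p q]
and of [q p] ([scalars_agree_qp], [scalars_agree_pq]), since for instance
[q p q p] can be read both as [r q p] and as [q t p].
In terms of
[u = p a q + q a p], [v = a p q + q p a] and [w = p a p q + q p a p]
one finds [[c, q] = 2 (t u - r^2 a) - w] ([bracket_conj_q]) and
[[q c q, p] = 2 t (w - (r + t) u)] ([bracket_compression_p]).
The [w] terms cancel because [t w = r w].  The [u] terms cancel because
[t^2 u = t r u], which holds since [t p = p q p] is a multiple of [p q].  Only
[- 4 r^3 a] is left. *)

(** * Central elements, brackets and the involution *)

Lemma mulr_centralCA {A : pzRingType} {z : A} (cz : central z) (x y : A) :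
  x * (z * y) = z * (x * y).
Proof. by rewrite !mulrA cz. Qed.

Lemma star_central (A : starRingType) (z : A) : central z -> central (star z).
Proof. by move=> cz x; rewrite -[x]starK /GRing.comm -!starM cz. Qed.

Lemma starB (A : starRingType) (x y : A) : star (x - y) = star x - star y.
Proof. by apply/eqP; rewrite eq_sym subr_eq -starD subrK. Qed.

Lemma star_bracket (A : starRingType) (x y : A) :
  star (bracket x y) = bracket (star y) (star x).
Proof. by rewrite /bracket starB !starM. Qed.

Lemma bracketDl (A : pzRingType) (x y z : A) :
  bracket (x + y) z = bracket x z + bracket y z.
Proof. by rewrite /bracket mulrDl mulrDr opprD addrACA. Qed.

Lemma bracket_centrall {A : pzRingType} {z : A} (cz : central z) (x y : A) :
  bracket (z * x) y = z * bracket x y.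
Proof. by rewrite /bracket mulrBr (mulr_centralCA cz) !mulrA. Qed.

Lemma bracket_centralr {A : pzRingType} {z : A} (cz : central z) (x y : A) :
  bracket x (z * y) = z * bracket x y.
Proof. by rewrite /bracket mulrBr (mulr_centralCA cz) !mulrA. Qed.

(** * Tangent vectors to the idempotents *)

Definition tangent {A : pzRingType} (q x : A) : Prop := q * x + x * q = x.

Lemma dual_idempotentP (A : pzRingType) (q a : A) :
  is_idempotent (dual_const q + eps * dual_const a)
  <-> q * q = q /\ tangent q a.
Proof.
rewrite dual_eps_decomp /is_idempotent /tangent.
rewrite -[Dual q a * Dual q a]/(Dual (q * q) (q * a + a * q)).
by split=> [[]|[-> ->]].
Qed.

Lemma tangentD (A : pzRingType) (q x y : A) :
  tangent q x -> tangent q y -> tangent q (x + y).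
Proof. by rewrite /tangent mulrDr mulrDl addrACA => -> ->. Qed.

Lemma tangentZ (A : pzRingType) (q z x : A) :
  central z -> tangent q x -> tangent q (z * x).
Proof.
by move=> cz tx; rewrite /tangent (mulr_centralCA cz) -mulrA -mulrDr tx.
Qed.

Lemma tangent_bracket (A : pzRingType) (q x : A) :
  q * q = q -> tangent q (bracket x q).
Proof.
move=> qq; rewrite /tangent /bracket mulrBr mulrBl !mulrA qq.
by rewrite -(mulrA x) qq addrC addrA subrK.
Qed.

Lemma tangent_bracket_compression (A : pzRingType) (q p r x : A) :
    central r -> q * q = q -> q * p * q = r * q ->
  tangent q (bracket (q * x * q) p).
Proof.
move=> cr qq qpq; rewrite /tangent /bracket mulrBr mulrBl !mulrA qq qpq.
rewrite -(mulrA (p * q * x) q q) qq -!(mulrA (q * x)) qpq.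
by rewrite (mulr_centralCA cr) !mulrA addrA subrK.
Qed.

(** * The square of the operator *)

Section TwoIdempotents.

Variables (A : pzRingType) (q p r t : A).
Hypotheses (cr : central r) (ct : central t).
Hypotheses (qpq : q * p * q = r * q) (pqp : p * q * p = t * p).

Lemma scalars_agree_qp : t * (q * p) = r * (q * p).
Proof. by rewrite -(mulr_centralCA ct) -pqp !mulrA qpq. Qed.

Lemma scalars_agree_pq : t * (p * q) = r * (p * q).
Proof. by rewrite mulrA -pqp -(mulr_centralCA cr) -qpq !mulrA. Qed.

Lemma scalars_agree_p : t * (t * p) = r * (t * p).
Proof. by rewrite -pqp !(mulrA _ _ p) scalars_agree_pq. Qed.

Variable a : A.
Hypotheses (qq : q * q = q) (qa : tangent q a).

Let u := p * a * q + q * a * p.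
Let v := a * (p * q) + q * p * a.
Let w := p * a * (p * q) + q * p * (a * p).

Lemma scalars_agree_u : t * (t * u) = r * (t * u).
Proof.
rewrite /u !mulrDr -!(mulr_centralCA ct (q * a)) -!(mulr_centralCA cr (q * a))
  scalars_agree_p.
by rewrite -(mulrA p) !(mulrA _ p) !(mulrA _ (t * p)) scalars_agree_p.
Qed.

Lemma scalars_agree_v : t * v = r * v.
Proof.
rewrite /v !mulrDr -(mulr_centralCA ct a) -(mulr_centralCA cr a)
  scalars_agree_pq.
by rewrite !(mulrA _ (q * p)) scalars_agree_qp.
Qed.

Lemma scalars_agree_w : t * w = r * w.
Proof.
rewrite /w !mulrDr -(mulr_centralCA ct (p * a)) -(mulr_centralCA cr (p * a))
  scalars_agree_pq.
by rewrite !(mulrA _ (q * p)) scalars_agree_qp.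
Qed.

Lemma aqE : a * q = a - q * a.
Proof. by rewrite -{2}qa addrC addKr. Qed.

Lemma qaE : q * a = a - a * q.
Proof. by rewrite aqE subKr. Qed.

(** Replacing the inner [a] by [q a + a q] puts a factor [q p q = r q] in each
term; the tangency of [a] then turns [q a p q + q p a q] into [v - r a].  This
is the only source of a term in [a] alone. *)
Lemma compression_conj : q * (p * a * p) * q = r * (v - r * a).
Proof.
have -> : q * (p * a * p) * q = r * (q * a * (p * q) + q * p * (a * q)).
  rewrite -{1}qa mulrDr !(mulrDr, mulrDl) !mulrA qpq; congr (_ + _).
  rewrite -(mulrA (_ * q) p q) -(mulrA (_ * a) q) (mulrA q p q) qpq.
  by rewrite (mulr_centralCA cr) !mulrA.
rewrite qaE {2}aqE mulrBl mulrBr -(mulrA a q) !(mulrA q) (mulrA (q * p)) qpq.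
rewrite (mulr_centralCA cr) -(mulrA r q a) addrACA -opprD -mulrDr.
by rewrite (addrC (a * q)) qa.
Qed.

(** This is the element [star (Lq q a)], written without the involution. *)
Let c := t * bracket p a *+ 2 + bracket q (p * a * p).

(** The element [v] enters twice, with coefficient [- t] from [[[p, a], q]] and
[r] from the compression of [p a p] by [q]; it cancels because [t v = r v]. *)
Lemma bracket_conj_q : bracket c q = (t * u - r * (r * a)) *+ 2 - w.
Proof.
have first_part : bracket (bracket p a) q = u - v.
  by rewrite /u /v /bracket !(mulrBl, mulrBr) opprB addrACA -opprD !mulrA.
have second_part : bracket (bracket q (p * a * p)) q =
    (q * (p * a * p) * q) *+ 2 - w.
  rewrite /w /bracket mulrBl mulrBr (mulrA q q) -(mulrA _ q q) qq opprB.
  by rewrite addrACA -opprD mulr2n !mulrA.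
rewrite bracketDl second_part compression_conj mulr2n bracketDl -mulr2n.
rewrite (bracket_centrall ct) first_part addrA -mulrnDl; congr (_ *+ 2 - w).
by rewrite !mulrBr scalars_agree_v addrA subrK.
Qed.

(** Only [[p, a]] contributes to [q c q], since [q [q, y] q = 0]. *)
Lemma bracket_compression_p :
  bracket (q * c * q) p = (t * (w - (r + t) * u)) *+ 2.
Proof.
have cE : q * c * q = t * (q * p * a * q - q * a * p * q) *+ 2.
  have qyq0 : q * bracket q (p * a * p) * q = 0.
    by rewrite /bracket mulrBr mulrBl mulrA qq -!mulrA qq subrr.
  rewrite /c mulrDr mulrDl qyq0 addr0 mulrnAr mulrnAl (mulr_centralCA ct).
  by rewrite -(mulrA t) /bracket mulrBr mulrBl !mulrA.
rewrite cE mulr2n bracketDl -mulr2n (bracket_centrall ct).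
congr (t * _ *+ 2); rewrite /bracket mulrBl mulrBr.
have -> : q * p * a * q * p = q * p * (a * p) - r * (q * a * p).
  rewrite -(mulrA (q * p) a) aqE mulrBr mulrBl (mulrA _ q a) qpq.
  by rewrite !mulrA.
have -> : q * a * p * q * p = t * (q * a * p).
  by rewrite -!(mulrA (q * a)) pqp (mulr_centralCA ct).
have -> : p * (q * p * a * q) = t * (p * a * q).
  by rewrite !mulrA pqp.
have -> : p * (q * a * p * q) = p * a * (p * q) - r * (p * a * q).
  rewrite -(mulrA (q * a)) qaE mulrBl mulrBr -(mulrA a) (mulrA q p) qpq.
  by rewrite !(mulr_centralCA cr) !mulrA.
rewrite /w /u mulrDl !mulrDr.
rewrite opprB -(addrA (q * p * _)) -opprD -(addrA (p * a * _)) -opprD addrACA.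
by rewrite -opprD [RHS]addrC addrC [in RHS]addrACA (addrC (r * _ + t * _))
  (addrC (q * p * _)).
Qed.

Lemma bracket_square :
  r * bracket c q *+ 2 + bracket (q * c * q) p = - (4%:R * r ^+ 3 * a).
Proof.
rewrite bracket_conj_q bracket_compression_p -mulrnDl.
have -> : t * (w - (r + t) * u) = r * w - r * (t * u) *+ 2.
  rewrite mulrBr mulrDl mulrDr (mulr_centralCA cr) scalars_agree_u -mulr2n.
  by rewrite scalars_agree_w.
rewrite mulrBr addrA subrK mulrnAr -mulrnBl mulrBr addrAC subrr add0r.
rewrite -mulrnA mulNrn -mulrA mulr_natl.
by rewrite !exprS expr0 mulr1 !mulrA.
Qed.

End TwoIdempotents.

(** * The operator in the ring with involution *)

Lemma LqE (A : starRingType) (q a r : A) :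
    central r -> q * star q * q = r * q ->
  Lq q a = r * bracket (star a) q *+ 2 + bracket (q * star a * q) (star q).
Proof. by move=> cr qpq; rewrite /Lq qpq (bracket_centralr cr) mulr_natl. Qed.

Lemma star_compression (A : starRingType) (q r : A) :
    central r -> q * star q * q = r * q ->
  star q * q * star q = star r * star q.
Proof.
move=> cr qpq; have := congr1 star qpq.
by rewrite !starM starK mulrA => ->; rewrite (star_central A r cr).
Qed.

Lemma star_Lq (A : starRingType) (q a r : A) :
    central r -> q * star q * q = r * q ->
  star (Lq q a) =
    star r * bracket (star q) a *+ 2 + bracket q (star q * a * star q).
Proof.
move=> cr qpq; rewrite (LqE _ _ _ _ cr qpq) starD mulr2n starD -mulr2n.
rewrite starM !star_bracket !starM !starK mulrA.
by rewrite (star_central A r cr).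
Qed.

Lemma Lq_central (A : starRingType) (q a s : A) :
  central s -> Lq q (s * a) = star s * Lq q a.
Proof.
move=> cs; have cs' := star_central A s cs.
rewrite /Lq starM -cs' (bracket_centrall cs') !(mulr_centralCA cs').
by rewrite -(mulrA (star s)) (bracket_centrall cs') -mulrDr.
Qed.

Theorem lemma1p3p2 (A : starRingType) (q a : A)
    (hidem : is_idempotent (dual_const q + eps * dual_const a))
    (hq : exists2 z : A, central z & q * star q * q = z * q) :
  [/\ is_idempotent (dual_const q + eps * dual_const (Lq q a)),
      forall r : A, central r -> q * star q * q = r * q ->
        Lq q (Lq q a) = - (4%:R * r ^+ 3 * a)
    & forall s : A, central s -> Lq q (s * a) = star s * Lq q a].
Proof.
have [qq qa] := (dual_idempotentP _ _ _).1 hidem; split.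
- have [z cz qpq] := hq; apply/dual_idempotentP; split=> //.
  rewrite (LqE _ _ _ _ cz qpq) mulr2n.
  have tbr := tangentZ _ _ _ _ cz (tangent_bracket _ q (star a) qq).
  apply: tangentD (tangentD _ _ _ _ tbr tbr) _.
  exact: tangent_bracket_compression cz qq qpq.
- move=> r cr qpq; rewrite (LqE _ _ _ _ cr qpq) (star_Lq _ _ _ _ cr qpq).
  apply: (bracket_square _ _ _ _ _ cr (star_central _ _ cr)) => //.
  exact: star_compression.
- by move=> s; apply: Lq_central.
Qed.
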